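(* Let $E$ be the set of edges of the complete graph $K_n$ on $n$ vertices, and let $B$ be the set of cyclic subgraphs of $K_n$ with $\hat{k}$ vertices, for $\hat{k} \geq 3$, each cycle being regarded as a block via its set of edges. If $n = 2\hat{k} - 3$, the pair $(E, B)$ forms a balanced incomplete block design, denoted a KC design, with parameters $(v,b,r,k,\lambda)$ given by \begin{align*} v & = \binom{2 \hat{k} - 3}{2}, \\ b & = \frac{(2 \hat{k} - 3)!}{2 \hat{k} (\hat{k} - 3)!}, \\ r & = \frac{(2 \hat{k} - 5)!}{(\hat{k} - 3)!}, \\ k & = \hat{k}, \\ \lambda & = \frac{(2 \hat{k} - 6)!}{(\hat{k} - 3)!}. \end{align*}
   Context: Graphs are finite, simple and undirected; edges are unordered pairs of distinct vertices. $K_n$ is the graph on $n$ vertices in which every two distinct vertices are adjacent. A cyclic subgraph (cycle) with $m \geq 3$ vertices is a subgraph consisting of $m$ distinct vertices $x_1, \dots, x_m$ and the $m$ edges $\{x_1,x_2\}, \{x_2,x_3\}, \dots, \{x_{m-1},x_m\}, \{x_m,x_1\}$; cycles have no distinguished starting vertex or direction, so cyclic rotations and reversals of $x_1 \cdots x_m$ give the same cycle. A balanced incomplete block design (BIBD) with parameters $(v,b,r,k,\lambda)$ is an ordered pair $(V,B)$ of a set $V$ of varieties and a set $B$ of subsets of $V$ called blocks such that $|V| = v$, $|B| = b$, each variety is an element of exactly $r$ blocks, each block has size $k$ (with $k < v$), and each pair of varieties is a subset of exactly $\lambda$ blocks.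
   Formalization: For k̂ = 3 we have v = k = 3, so the BIBD requirement k < v fails; the full BIBD claim is therefore proved for k̂ > 3, while for k̂ = 3 every other clause and all parameter formulas are proved. *)

(* Defs.v *)
From mathcomp Require Import all_boot all_order all_algebra.

Set Implicit Arguments.
Unset Strict Implicit.
Unset Printing Implicit Defensive.

(* All the clauses of the definition of a BIBD except incompleteness,
   k < v. They are separated because K_3 has a single triangle, which contains
   all three edges: there k = v = 3. *)
Definition balanced_design (T : finType) (V : {set T}) (B : {set {set T}})
    (v b r k lambda : nat) : Prop :=
  [/\ (forall A : {set T}, A \in B -> A \subset V),
      #|V| = v /\ #|B| = b,
      (forall x : T, x \in V -> #|[set A in B | x \in A]| = r),
      (forall A : {set T}, A \in B -> #|A| = k)
    & (forall x y : T, x \in V -> y \in V -> x != y ->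
         #|[set A in B | [set x; y] \subset A]| = lambda)].

Definition bibd (T : finType) (V : {set T}) (B : {set {set T}})
    (v b r k lambda : nat) : Prop :=
  balanced_design V B v b r k lambda /\ k < v.

Definition complete_edges (n : nat) : {set {set 'I_n}} :=
  [set e : {set 'I_n} | #|e| == 2].

(* A subgraph of K_n is given by its vertex set and its edge set. Since ordS is
   the successor modulo m, the closing edge {x_m, x_1} is included. For m >= 3
   and x injective this is a cycle; sequences that differ by rotation or
   reversal give the same pair. *)
Definition cycle_of (n m : nat) (x : {ffun 'I_m -> 'I_n}) :
    {set 'I_n} * {set {set 'I_n}} :=
  ([set x i | i : 'I_m], [set [set x i; x (ordS i)] | i : 'I_m]).

Definition cyclic_subgraphs (n m : nat) :
    {set {set 'I_n} * {set {set 'I_n}}} :=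
  [set cycle_of x | x : {ffun 'I_m -> 'I_n} & injectiveb x].

Definition cycle_blocks (n m : nat) : {set {set {set 'I_n}}} :=
  [set C.2 | C in cyclic_subgraphs n m].

(* Main.v *)
Require Import Defs.
From mathcomp Require Import all_boot all_order all_algebra.
From mathcomp Require Import zify ring.

(** A cycle of K_n with k vertices is the edge set of an injective numbering
    x of its vertices by Z/k, consecutive positions being joined. The same
    cycle comes from 2k numberings, but only one of them starts along a given
    oriented edge: if {a, b} is an edge, some rotation or reflection of x has
    x 0 = a and x 1 = b ([cycle_edges_start]), and then every further vertex is
    forced, being the neighbour of the previous one not yet visited
    ([cycle_rigid]). So the cycles through {a, b} correspond bijectively to the
    injections x : Z/k -> {1..n} with x 0 = a and x 1 = b, and this bijection
    keeps track of any further condition on the edges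
    ([card_blocks_through]).

    An injection with s prescribed values can be completed in
    (n - s)^_(k - s) ways, a falling factorial ([card_inj_extensions]).
    - One edge prescribes two values, which gives r = (n - 2)^_(k - 2).
    - A second edge {b, c} sharing the vertex b forces x 2 = c, which gives
      (n - 3)^_(k - 3).
    - A second edge {c, d} disjoint from {a, b} may sit at any of k - 3
      positions in either direction, which gives
      2 (k - 3) (n - 4)^_(k - 4).

    As (n - 3)^_(k - 3) = (n - 3) (n - 4)^_(k - 4) for k >= 4, the last two
    numbers agree when n - 3 = 2 (k - 3), that is n = 2k - 3
    ([card_blocks_edge_pair]). The number of blocks then follows from the
    incidence count b k = v r ([design_incidence]).

    Throughout, k is written p + 3, so that positions live in the ring
    'I_p.+3, where rotations and reflections are i |-> t + i and
    i |-> t - i. *)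

Set Implicit Arguments.
Unset Strict Implicit.
Unset Printing Implicit Defensive.

Import GRing.Theory.

(** * Unordered pairs and extensions of partial injections *)

Lemma set2_eqP (T : finType) (a b c d : T) :
  reflect ((a = c /\ b = d) \/ (a = d /\ b = c)) ([set a; b] == [set c; d]).
Proof.
apply: (iffP eqP) => [E|[[-> ->] //|[-> ->]]]; last exact: setUC.
have := set21 a b; have := set22 a b; have := set21 c d; have := set22 c d.
rewrite {1 2}E -{1 2}E !inE.
by do 4 (case/orP=> /eqP ?); subst; auto.
Qed.

(** The induction goes down from a fully prescribed function: prescribing the
    value at one more position i splits the count according to x i, which can
    take any of the #|rT| - size s values not used yet. *)
Lemma card_inj_extensions (aT rT : finType) (s : seq aT) (t : seq rT) :
    uniq s -> uniq t -> size s = size t ->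
  #|[set x : {ffun aT -> rT} | injectiveb x & map x s == t]|
    = (#|rT| - size s) ^_ (#|aT| - size s).
Proof.
move Ed: (#|aT| - size s) => d; elim: d => [|d IHd] in s t Ed *
  => us ut est.
- have sT i : i \in s.
    have sE : #|s| = #|aT|.
      apply/eqP; rewrite eqn_leq max_card (card_uniqP us).
      by move/eqP: Ed.
    by rewrite (subset_cardP sE (subset_predT _)).
  (* Every position is prescribed, and x0 is the function this describes. *)
  have lt_t i : index i s < size t by rewrite -est index_mem.
  pose x0 : {ffun aT -> rT} := [ffun i => tnth (in_tuple t) (Ordinal (lt_t i))].
  have xE y0 i : x0 i = nth y0 t (index i s) by rewrite ffunE (tnth_nth y0).
  rewrite ffactn0 -(cards1 x0); apply: eq_card => x; rewrite !inE.
  apply/andP/eqP => [[_ /eqP xs]|->].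
    apply/ffunP => i; rewrite (xE (x i)) -xs.
    by rewrite (nth_map i) ?index_mem // nth_index.
  split.
    apply/injectiveP => i j; rewrite (xE (x0 i) i) (xE (x0 i) j) => /eqP.
    by rewrite nth_uniq // => /eqP /(congr1 (nth i s)); rewrite !nth_index.
  apply/eqP; case: (posnP (size s)) => [s0|].
    by rewrite (size0nil s0); apply/esym/size0nil; rewrite -est.
  rewrite -has_predT => /hasP[i _ _].
  apply: (@eq_from_nth _ (x0 i)) => [|j]; rewrite size_map // => js.
  by rewrite (nth_map i) // (xE (x0 i)) index_uniq.
have [i iNs] : exists i, i \notin s.
  apply/existsP; rewrite -negb_forall; apply/negP => /forallP sT.
  suff : #|aT| <= size s by lia.
  by rewrite cardE uniq_leq_size ?enum_uniq.
(* A value y in t is already taken, so it accounts for no injection. *)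
rewrite -sum1dep_card (partition_big (fun x : {ffun aT -> rT} => x i) predT) //=.
transitivity (\sum_(y | y \notin t) (#|rT| - (size s).+1) ^_ d).
  rewrite (bigID (mem t)) /= big1 ?add0n => [|y yt].
    apply: eq_bigr => y yNt.
    rewrite -(IHd (i :: s) (y :: t)) /= ?iNs ?yNt ?est ?subnS -?est ?Ed //.
    rewrite -sum1dep_card; apply: eq_bigl => x.
    by rewrite eqseq_cons -andbA [(_ == t) && _]andbC.
  apply: big1 => x /andP[/andP[/injectiveP xI /eqP xs] /eqP xi].
  by case/negP: iNs; rewrite -(mem_map xI) xs xi.
rewrite sum_nat_const.
have -> : #|[pred y | y \notin t]| = #|rT| - size s.
  by rewrite est -(card_uniqP ut) -(cardC [in t]) addKn.
by case: (#|rT| - size s) (subnS #|rT| (size s)) => [|N] -> //; rewrite ffactnS.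
Qed.

(** * Cycles as numberings by Z/k *)

(** For T = 'I_n this is convertible to the second component of cycle_of x. *)
Definition cycle_edges (m : nat) (T : finType) (x : 'I_m -> T) : {set {set T}} :=
  [set [set x i; x (ordS i)] | i : 'I_m].

Lemma cycle_blocksP n m (A : {set {set 'I_n}}) :
  reflect (exists2 x : {ffun 'I_m -> 'I_n}, injective x & A = cycle_edges x)
          (A \in cycle_blocks n m).
Proof.
apply: (iffP imsetP) => [[C /imsetP[x]]|[x xI ->]].
  by rewrite inE => /injectiveP xI -> ->; exists x.
by exists (cycle_of x) => //; apply: imset_f; rewrite inE; apply/injectiveP.
Qed.

Section Cycles.
Local Open Scope ring_scope.

Lemma ordS_add1 p (i : 'I_p.+2) : ordS i = i + 1.
Proof. by apply: val_inj; rewrite /= modnDmr addn1. Qed.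

(** Where k >= 3 matters: the two neighbours i + 1 and i - 1 of a position are
    distinct. *)
Lemma Zp_two_neq0 p : (1 + 1 : 'I_p.+3) != 0.
Proof. by []. Qed.

Section Fixed.
Variables (p : nat) (T : finType).
Implicit Types (x y : 'I_p.+3 -> T) (u v a b c d : T).

Lemma mem_cycle_edges x u v :
  reflect (exists i, (u = x i /\ v = x (i + 1)) \/ (v = x i /\ u = x (i + 1)))
          ([set u; v] \in cycle_edges x).
Proof.
apply: (iffP imsetP) => [[i _ /eqP/set2_eqP E]|[i E]]; exists i => //.
  by move: E; rewrite ordS_add1 => -[] [-> ->]; [left|right].
by apply/eqP/set2_eqP; rewrite ordS_add1; case: E => -[-> ->]; auto.
Qed.

Lemma cycle_edges_shift x t : cycle_edges (fun i => x (t + i)) = cycle_edges x.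
Proof.
apply/setP => e; apply/imsetP/imsetP => -[i _ ->].
  by exists (t + i); rewrite // !ordS_add1 addrA.
by exists (i - t); rewrite // !ordS_add1 !addrA ![t + i]addrC !addrK.
Qed.

Lemma cycle_edges_flip x t : cycle_edges (fun i => x (t - i)) = cycle_edges x.
Proof.
apply/setP => e; apply/imsetP/imsetP => -[i _ ->].
  by exists (t - i - 1); rewrite // !ordS_add1 subrK setUC opprD addrA.
exists (t - i - 1); rewrite // !ordS_add1 subrK subKr setUC.
by rewrite (_ : t - (t - i - 1) = i + 1) //; ring.
Qed.

Section Injective.
Variable x : 'I_p.+3 -> T.
Hypothesis xI : injective x.

Lemma cycle_neighbours i v :
  ([set x i; v] \in cycle_edges x) = (v == x (i + 1)) || (v == x (i - 1)).
Proof.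
apply/mem_cycle_edges/orP => [[j [[/xI-> ->]|[-> /xI->]]]|[] /eqP->].
- by left.
- by right; rewrite addrK.
- by exists i; left.
by exists (i - 1); right; rewrite subrK.
Qed.

Lemma card_cycle_edges : #|cycle_edges x| = p.+3.
Proof.
rewrite card_imset ?card_ord // => i j /eqP/set2_eqP; rewrite !ordS_add1.
case=> -[/xI // + /xI] => -> /eqP.
rewrite -addrA addrC -subr_eq0 addrK.
by rewrite (negbTE (Zp_two_neq0 p)).
Qed.

Lemma cycle_edges_card2 e : e \in cycle_edges x -> #|e| = 2.
Proof.
case/imsetP => i _ ->; rewrite cards2 ordS_add1 (inj_eq xI).
by rewrite -subr_eq0 opprD addNKr oppr_eq0 oner_eq0.
Qed.

(** Rotate or reflect the numbering, according to the direction in which it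
    runs along the edge. *)
Lemma cycle_edges_start a b : [set a; b] \in cycle_edges x ->
  exists2 y : {ffun 'I_p.+3 -> T}, injective y /\ cycle_edges y = cycle_edges x
    & y 0 = a /\ y 1 = b.
Proof.
case/mem_cycle_edges => t [[-> ->]|[-> ->]].
  exists [ffun i => x (t + i)]; last by rewrite !ffunE addr0.
  split; first by move=> i j; rewrite !ffunE => /xI/addrI.
  rewrite -[RHS](cycle_edges_shift x t).
  by apply: eq_imset => i; rewrite !ffunE.
exists [ffun i => x (t + 1 - i)]; last by rewrite !ffunE subr0 addrK.
split; first by move=> i j; rewrite !ffunE => /xI/addrI/oppr_inj.
rewrite -[RHS](cycle_edges_flip x (t + 1)).
by apply: eq_imset => i; rewrite !ffunE.
Qed.

(** If x and y agree at j and j + 1, then x (j + 2) is a neighbour of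
    y (j + 1) along y, hence y j or y (j + 2); it is not y j = x j since
    j + 2 <> j. *)
Lemma cycle_rigid y : injective y -> cycle_edges x = cycle_edges y ->
  x 0 = y 0 -> x 1 = y 1 -> x =1 y.
Proof.
move=> yI E E0 E1 i; rewrite -[i]valZpK.
(* Induction needs the agreement at two consecutive positions. *)
suff: forall k, x (inZp k) = y (inZp k) /\ x (inZp k + 1) = y (inZp k + 1).
  by move=> /(_ i)[].
elim => [|k [IH0 IH1]].
  by rewrite (_ : inZp 0 = 0) ?add0r //; apply: val_inj.
have S: inZp k.+1 = inZp k + 1 :> 'I_p.+3.
  by apply: val_inj; rewrite /= modnDmr modnDml addn1.
rewrite S; split => //; move: (inZp k) IH0 IH1 => j IH0 IH1.
have /mem_cycle_edges : [set y (j + 1); x (j + 1 + 1)] \in cycle_edges y.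
  by rewrite -IH1 -E cycle_neighbours eqxx.
case=> l [[/yI <- ->] //|[xl /yI/addIr ljE]].
move: xl; rewrite -ljE -IH0 => /xI /eqP.
by rewrite -subr_eq0 -[_ + 1]addrA addrAC subrr add0r (negbTE (Zp_two_neq0 p)).
Qed.

End Injective.
End Fixed.

(** The correspondence between cycles through an edge and numberings that
    start along it; P carries the condition of containing a second edge. *)
Lemma card_blocks_through p n (a b : 'I_n) (P : pred {set {set 'I_n}}) :
  #|[set A in cycle_blocks n p.+3 | ([set a; b] \in A) && P A]|
    = #|[set x : {ffun 'I_p.+3 -> 'I_n} |
         [&& injectiveb x, map x [:: 0; 1] == [:: a; b] & P (cycle_edges x)]]|.
Proof.
pose E (x : {ffun 'I_p.+3 -> 'I_n}) := cycle_edges x.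
rewrite -[RHS](@card_in_imset _ _ E) => [|x y]; last first.
  rewrite !inE => /and3P[/injectiveP xI /eqP[x0 x1] _].
  move=> /and3P[/injectiveP yI /eqP[y0 y1] _] Exy; apply/ffunP.
  by apply: cycle_rigid => //; rewrite ?x0 ?x1.
apply: eq_card => A; rewrite !inE; apply/and3P/imsetP.
  case=> /cycle_blocksP[x xI ->] xab PA.
  have [y [yI Ey] [y0 y1]] := cycle_edges_start xI xab.
  by exists y => //; rewrite inE Ey PA /= y0 y1 eqxx !andbT; apply/injectiveP.
case=> x; rewrite inE => /and3P[/injectiveP xI /eqP[x0 x1] Px] ->.
split=> //; first by apply/cycle_blocksP; exists x.
by apply/mem_cycle_edges; exists 0; left; rewrite add0r x0 x1.
Qed.

(** The positions j whose edge {j, j + 1} is disjoint from {0, 1} are those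
    other than 0, 1 and -1. *)
Lemma card_far_positions p :
  #|[pred j : 'I_p.+3 | uniq [:: 0; 1; j; j + 1]]| = p.
Proof.
have us : uniq [:: 0; 1; -1 : 'I_p.+3].
  have n0 : (0 : 'I_p.+3) != -1 by rewrite eq_sym oppr_eq0 oner_eq0.
  have n1 : (1 : 'I_p.+3) != -1 by rewrite -addr_eq0 Zp_two_neq0.
  by rewrite /= !inE negb_or n0 n1.
have := cardC [in [:: 0; 1; -1 : 'I_p.+3]].
rewrite (card_uniqP us) card_ord => -[pE]; rewrite -[RHS]pE.
apply: eq_card => j; rewrite !inE /= !inE !negb_or andbT.
have -> : (0 == j + 1) = (j == -1) by rewrite eq_sym addr_eq0.
have -> : (1 == j + 1) = (j == 0) by rewrite eq_sym -subr_eq0 addrK.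
have -> : (j == j + 1) = false.
  by rewrite eq_sym -subr_eq0 addrAC subrr add0r oner_eq0.
rewrite [0 == j]eq_sym [1 == j]eq_sym.
by case: (j == 0); case: (j == 1); case: (j == -1).
Qed.

End Cycles.

(** * Blocks through one or two edges *)

(** An edge occurs at one position and in one direction only; written as a
    sum of indicators, this turns the count of cycles with a second edge into
    a sum over the position of that edge. *)
Lemma cycle_edge_positions p (T : finType) (x : 'I_p.+3 -> T) c d :
    injective x -> c != d ->
  ([set c; d] \in cycle_edges x)
    = \sum_(j : 'I_p.+3) (map x [:: j; j + 1]%R == [:: c; d])
      + \sum_(j : 'I_p.+3) (map x [:: j; j + 1]%R == [:: d; c]) :> nat.
Proof.
move=> xI cd.
have once i : \sum_(j : 'I_p.+3) (map x [:: j; j + 1]%R == [:: x i; x (i + 1)%R]) = 1.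
  rewrite (bigD1 i) //= eqxx big1 // => j ji.
  by rewrite eqseq_cons (inj_eq xI) (negbTE ji).
(* Traversing the edge backwards at j would need j = i + 1 and j + 1 = i. *)
have never i : \sum_(j : 'I_p.+3) (map x [:: j; j + 1]%R == [:: x (i + 1)%R; x i]) = 0.
  rewrite big1 // => j _; rewrite /= eqseq_cons eqseq_cons andbT !(inj_eq xI).
  case: eqP => // ->; apply/eqP; rewrite eqb0 -subr_eq0 -[(i + 1 + 1)%R]addrA addrAC subrr add0r.
  exact: Zp_two_neq0.
case: mem_cycle_edges => [[i [[-> ->]|[-> ->]]]|no]; rewrite ?once ?never //.
rewrite !big1 // => j _; apply/eqP; rewrite eqb0; apply/negP => /eqP[jE j1E];
  by case: no; exists j; rewrite jE j1E; auto.
Qed.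

Section Counts.
Variables (p n : nat).
Notation B := (cycle_blocks n p.+3).

Lemma card_blocks_edge (a b : 'I_n) : a != b ->
  #|[set A in B | [set a; b] \in A]| = (n - 2) ^_ p.+1.
Proof.
move=> ab; have := card_blocks_through p a b predT.
have := card_inj_extensions (s := [:: 0%R; 1%R : 'I_p.+3]) (t := [:: a; b]).
rewrite !card_ord /= inE ab => <- // E.
transitivity #|[set A in B | ([set a; b] \in A) && predT A]|.
  by apply: eq_card => A; rewrite !inE andbT.
by rewrite E; apply: eq_card => x; rewrite !inE /= andbT.
Qed.

(** Since x 1 = b has neighbours x 0 = a and x 2, containing {b, c} amounts to
    x 2 = c. *)
Lemma card_blocks_adjacent (a b c : 'I_n) : uniq [:: a; b; c] ->
  #|[set A in B | ([set a; b] \in A) && ([set b; c] \in A)]| = (n - 3) ^_ p.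
Proof.
move=> abc; rewrite (card_blocks_through p a b (fun A => [set b; c] \in A)).
have := card_inj_extensions (s := [:: 0; 1; 1 + 1 : 'I_p.+3]%R) (t := [:: a; b; c]) isT abc erefl.
rewrite !card_ord [p.+3 - _]subn0 => <-.
apply: eq_card => x; rewrite !inE /= !eqseq_cons.
case: injectiveP => //= xI; case: eqP => //= x0; case: eqP => //= <-.
rewrite cycle_neighbours // subrr x0 [c == a]eq_sym.
by move: abc; rewrite /= !inE negb_or -andbA => /and3P[_ /negbTE-> _]; rewrite orbF andbT eq_sym.
Qed.

(** Summing over the position j and the direction of {c, d}, the positions
    0, 1, j, j + 1 carry prescribed values; only the p positions j away from
    the edge {0, 1} contribute. *)
Lemma card_blocks_disjoint (a b c d : 'I_n) : uniq [:: a; b; c; d] ->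
  #|[set A in B | ([set a; b] \in A) && ([set c; d] \in A)]|
    = 2 * p * (n - 4) ^_ p.-1.
Proof.
move=> abcd; rewrite (card_blocks_through p a b (fun A => [set c; d] \in A)).
pose N c d (j : 'I_p.+3) := #|[set x : {ffun 'I_p.+3 -> 'I_n} |
   injectiveb x & map x [:: 0; 1; j; j + 1]%R == [:: a; b; c; d]]|.
have sumN c' d' : uniq [:: a; b; c'; d'] -> \sum_j N c' d' j = p * (n - 4) ^_ p.-1.
  move=> u; rewrite (bigID (fun j : 'I_p.+3 => uniq [:: 0; 1; j; j + 1]%R)) /=.
  rewrite [X in (_ + X)%N]big1 ?addn0 => [|j ju].
    rewrite (eq_bigr (fun=> (n - 4) ^_ p.-1)) => [|j ju].
      by rewrite sum_nat_const card_far_positions.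
    by rewrite /N card_inj_extensions // !card_ord [p.+3 - _]subn1.
  apply: eq_card0 => x; rewrite inE; apply/negP => /andP[/injectiveP xI /eqP xs].
  by case/negP: ju; rewrite -xs (map_inj_uniq xI) in u.
have cd : c != d by move: abcd; rewrite /= !inE => /and4P[].
have adbc : uniq [:: a; b; d; c].
  by rewrite (perm_uniq (s2 := [:: a; b; c; d])) // !perm_cons (perm_catC [:: d] [:: c]).
rewrite -mulnA mul2n -addnn -{1}(sumN c d) // -(sumN d c) //.
rewrite -sum1dep_card big_mkcond /=.
pose M c d (j : 'I_p.+3) (x : {ffun 'I_p.+3 -> 'I_n}) :=
  injectiveb x && (map x [:: 0; 1; j; j + 1]%R == [:: a; b; c; d]).
have NE c' d' : \sum_j N c' d' j = \sum_x \sum_j M c' d' j x.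
  rewrite exchange_big; apply: eq_bigr => j _.
  by rewrite /N -sum1dep_card big_mkcond; apply: eq_bigr => x _; rewrite /M; case: ifP.
rewrite !NE -big_split; apply: eq_bigr => x _ /=.
have ME c' d' : \sum_j M c' d' j x
    = (injectiveb x && (map x [:: 0; 1]%R == [:: a; b]))
      * \sum_(j : 'I_p.+3) (map x [:: j; j + 1]%R == [:: c'; d']).
  rewrite big_distrr /=; apply: eq_bigr => j _; rewrite /M mulnb /= !eqseq_cons.
  by rewrite !andbT !andbA.
rewrite !ME -mulnDr andbA; case: injectiveP => [xI|] //=.
rewrite -(cycle_edge_positions xI cd).
by rewrite mulnb; case: (_ && _).
Qed.

End Counts.

(** Here n - 3 = 2p merges the adjacent and the disjoint case, as
    (2p)^_p = 2p (2p - 1)^_(p - 1). *)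
Lemma card_blocks_edge_pair p (e f : {set 'I_(2 * p + 3)}) :
    #|e| = 2 -> #|f| = 2 -> e != f ->
  #|[set A in cycle_blocks (2 * p + 3) p.+3 | (e \in A) && (f \in A)]|
    = (2 * p) ^_ p.
Proof.
have adjacent (s a b : 'I_(2 * p + 3)) : s != a -> s != b -> [set s; a] != [set s; b] ->
    #|[set A in cycle_blocks (2 * p + 3) p.+3
       | ([set s; a] \in A) && ([set s; b] \in A)]| = (2 * p) ^_ p.
  rewrite [[set s; a]]setUC => sa sb ab; rewrite card_blocks_adjacent ?addnK //=.
  rewrite !inE negb_or sb eq_sym sa !andbT.
  by apply: contraNneq ab => ->; rewrite setUC.
move=> /eqP/cards2P[a [b [ab ->]]] /eqP/cards2P[c [d [cd ->]]].
have [ca|ac] := eqVneq a c; first by move: cd; rewrite -ca; apply: adjacent.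
have [da|ad] := eqVneq a d.
  by move: cd; rewrite -da eq_sym [[set c; a]]setUC; apply: adjacent.
have [cb|bc] := eqVneq b c.
  by move: ab cd; rewrite -cb eq_sym [[set a; b]]setUC => ba; apply: adjacent.
have [db|bd] := eqVneq b d.
  move: ab cd; rewrite -db eq_sym [c == b]eq_sym [[set a; b]]setUC [[set c; b]]setUC.
  exact: adjacent.
move=> _.
have u : uniq [:: a; b; c; d] by rewrite /= !inE !negb_or ab ac ad bc bd cd.
rewrite card_blocks_disjoint //.
(* For p = 0 the two sides would be 0 and 0^_0 = 1, but K_3 has no two
   disjoint edges. *)
have p0 : 0 < p.
  by have := max_card [in [:: a; b; c; d]]; rewrite (card_uniqP u) card_ord /=; lia.
case: (p) p0 => // q _; rewrite (_ : 2 * q.+1 + 3 - 4 = (2 * q.+1).-1); last by lia.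
by rewrite ffactnS.
Qed.

(** * The design *)

(** Count the incident pairs (x, A) in two ways. *)
Lemma design_incidence (T : finType) (V : {set T}) (B : {set {set T}}) r k :
    (forall A : {set T}, A \in B -> A \subset V) ->
    (forall x, x \in V -> #|[set A in B | x \in A]| = r) ->
    (forall A : {set T}, A \in B -> #|A| = k) ->
  #|B| * k = #|V| * r.
Proof.
move=> BV Vr Bk; rewrite -!sum_nat_const.
transitivity (\sum_(A in B) \sum_(x in A) 1).
  by apply: eq_bigr => A /Bk <-; rewrite sum1_card.
rewrite (exchange_big_dep [in V]) /= => [|A x /BV/subsetP/[apply]//].
apply: eq_bigr => x /Vr <-.
by rewrite sum1dep_card.
Qed.

Theorem theorem2p3 (n k : nat) (hk : 3 <= k) (hn : n = 2 * k - 3) :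
  exists b r lambda : nat,
    [/\ (b%:R = ((2 * k - 3)`!)%:R / (2 * k * (k - 3)`!)%:R :> rat)%R,
        (r%:R = ((2 * k - 5)`!)%:R / ((k - 3)`!)%:R :> rat)%R,
        (lambda%:R = ((2 * k - 6)`!)%:R / ((k - 3)`!)%:R :> rat)%R,
        balanced_design (complete_edges n) (cycle_blocks n k)
          'C(2 * k - 3, 2) b r k lambda
      & 3 < k -> bibd (complete_edges n) (cycle_blocks n k)
          'C(2 * k - 3, 2) b r k lambda].
Proof.
subst n; case: k hk => [|[|[|p]]] // _.
have -> : 2 * p.+3 - 3 = 2 * p + 3 by lia.
have -> : 2 * p.+3 - 5 = 2 * p + 1 by lia.
have -> : 2 * p.+3 - 6 = 2 * p by lia.
have -> : p.+3 - 3 = p by lia.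
set n := 2 * p + 3; set V := complete_edges n; set B := cycle_blocks n p.+3.
have cV : #|V| = 'C(n, 2) by rewrite card_draws card_ord.
have BV (A : {set {set 'I_n}}) : A \in B -> A \subset V.
  move=> /cycle_blocksP[x xI ->]; apply/subsetP => e /(cycle_edges_card2 xI) e2.
  by rewrite inE e2.
have Bk (A : {set {set 'I_n}}) : A \in B -> #|A| = p.+3.
  by move=> /cycle_blocksP[x xI ->]; apply: card_cycle_edges.
have Vr (e : {set 'I_n}) : e \in V -> #|[set A in B | e \in A]| = (2 * p + 1) ^_ p.+1.
  rewrite inE => /cards2P[a [b [ab ->]]]; rewrite card_blocks_edge //.
  by congr (_ ^_ _); rewrite /n; lia.
have Vl (e f : {set 'I_n}) : e \in V -> f \in V -> e != f ->
    #|[set A in B | [set e; f] \subset A]| = (2 * p) ^_ p.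
  rewrite !inE => /eqP e2 /eqP f2 ef; rewrite -(card_blocks_edge_pair e2 f2 ef).
  by apply: eq_card => A; rewrite !inE subUset !sub1set.
have rE : (2 * p + 1) ^_ p.+1 * p`! = (2 * p + 1)`!.
  by rewrite -[p in p`!](_ : 2 * p + 1 - p.+1 = p) ?ffact_fact; lia.
have lE : (2 * p) ^_ p * p`! = (2 * p)`!.
  by rewrite -[p in p`!](_ : 2 * p - p = p) ?ffact_fact; lia.
have vE : 'C(n, 2) * 2 = n ^_ 2 by exact: (bin_ffact n 2).
have n2 : n - 2 = 2 * p + 1 by rewrite /n; lia.
(* Multiply b k = v r by 2 (k - 3)!, using 2 v = n^_2. *)
have bE : #|B| * (2 * p.+3 * p`!) = n`!.
  rewrite (_ : _ * _ = #|B| * p.+3 * 2 * p`!); last by ring.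
  rewrite (design_incidence BV Vr Bk) cV -(@ffact_fact n 2) ?n2 -?vE -?rE; first by ring.
  by rewrite /n; lia.
have quot a b c : a * b = c -> 0 < b -> (a%:R = c%:R / b%:R :> rat)%R.
  by move=> <- b0; rewrite natrM mulfK // Num.Theory.pnatr_eq0 -lt0n.
have D : balanced_design V B 'C(n, 2) #|B| ((2 * p + 1) ^_ p.+1) p.+3 ((2 * p) ^_ p).
  by split.
exists #|B|, ((2 * p + 1) ^_ p.+1), ((2 * p) ^_ p); split=> //.
- by apply: quot => //; rewrite muln_gt0 fact_gt0.
- by apply: quot => //; rewrite fact_gt0.
- by apply: quot => //; rewrite fact_gt0.
move=> p0; split=> //; move: vE; rewrite ffactnS ffactn1 /n; nia.
Qed.
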